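(* Let $R$ be a properly stratified algebra having a simple preserving duality, and such that every classical tilting right $R$-module is also cotilting. Then $$\mathrm{Findim}(R_R)=\mathrm{findim}(R_R).$$
   Context: $R$ is a finite dimensional algebra over a field $k$ (in particular $R$ is right noetherian), and modules are right $R$-modules. $\mathrm{pd}$ and $\mathrm{id}$ denote projective and injective dimension. $\mathrm{Findim}(R_R)$ is the supremum of the projective dimensions of all right $R$-modules of finite projective dimension; $\mathrm{findim}(R_R)$ is the supremum of the projective dimensions of those right $R$-modules of finite projective dimension that admit a projective resolution consisting of finitely generated projective modules (here, equivalently, the finitely generated ones). Let $L(1),\dots,L(n)$ be representatives of the isomorphism classes of simple modules in a fixed linear order, with projective covers $P(i)$. The standard module $\Delta(i)$ is the largest quotient of $P(i)$ all of whose composition factors are $L(j)$ with $j\le i$; the proper standard module $\overline\Delta(i)$ is the largest quotient of $\Delta(i)$ in which $L(i)$ occurs exactly once as a composition factor. $R$ (with the fixed order) is properly stratified if for every $i$ the kernel of $P(i)\to\Delta(i)$ has a finite filtration with subquotients of the form $\Delta(j)$, $j>i$, and $\Delta(i)$ has a finite filtration with all subquotients isomorphic to $\overline\Delta(i)$. A simple preserving duality is an exact contravariant involutive equivalence of the category of finitely generated right $R$-modules with itself which fixes every simple module up to isomorphism. A classical tilting module is a finitely generated module $U$ with $\mathrm{pd}\,U<\infty$, $\mathrm{Ext}^i_R(U,U)=0$ for all $i>0$, and such that there is an exact sequence $0\to R_R\to U_0\to\cdots\to U_m\to 0$ with every $U_i$ in $\mathrm{add}\,U$ (direct summands of finite direct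 sums of copies of $U$). Dually, a finitely generated module $U$ is cotilting if $\mathrm{id}\,U<\infty$, $\mathrm{Ext}^i_R(U,U)=0$ for all $i>0$, and there is an exact sequence $0\to U_m\to\cdots\to U_0\to \mathrm{Hom}_k(R,k)\to 0$ with every $U_i\in\mathrm{add}\,U$. *)

(* Defs.v *)
From HB Require Import structures.
From mathcomp Require Import all_boot all_order all_algebra all_field.
From mathcomp Require Import boolp.

Set Implicit Arguments.
Unset Strict Implicit.
Unset Printing Implicit Defensive.

Import GRing.Theory.
Local Open Scope ring_scope.

(* A right R-module is a left module over the converse ring R^c; the scalar
   action r *: x stands for x r. No finiteness condition is imposed. *)
Notation rmod R := (lmodType R^c).

(* The right regular module R_R: r *: x is the product of x and r in R. *)
Notation regmod R := ((R^c)^o : rmod R).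

Section Modules.
Variable R : nzRingType.
Implicit Types M N P : rmod R.

Definition surj (A B : Type) (f : A -> B) : Prop := forall y, exists x, f x = y.

Definition isomorphic M N : Prop := exists f : {linear M -> N}, bijective f.

Definition zero_module M : Prop := forall x : M, x = 0.

Definition exact_at M N P (f : M -> N) (g : N -> P) : Prop :=
  forall y : N, g y = 0 <-> exists x, f x = y.

Definition short_exact M N P (f : {linear M -> N}) (g : {linear N -> P}) :
    Prop :=
  [/\ injective f, exact_at f g & surj g].

Definition fin_gen M : Prop :=
  exists (m : nat) (g : 'I_m -> M),
    forall x, exists c : 'I_m -> R^c, x = \sum_(i < m) c i *: g i.

Definition simple_module M : Prop :=
  (exists x : M, x != 0) /\
  forall S : {pred M}, submod_closed S ->
    (forall x, x \in S -> x = 0) \/ (forall x, x \in S).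

Definition projective P : Prop :=
  forall M N (g : {linear M -> N}) (f : {linear P -> N}), surj g ->
    exists h : {linear P -> M}, forall x, g (h x) = f x.

Definition injective_module (I : rmod R) : Prop :=
  forall M N (g : {linear M -> N}) (f : {linear M -> I}), injective g ->
    exists h : {linear N -> I}, forall x, h (g x) = f x.

(* p : P -> M is a projective cover: its kernel is superfluous. *)
Definition projective_cover P M (p : {linear P -> M}) : Prop :=
  [/\ projective P, surj p &
    forall S : {pred P}, submod_closed S ->
      (forall x, exists y z, [/\ y \in S, p z = 0 & x = y + z]) ->
      forall x, x \in S].

(* ... -> C 2 -> C 1 -> C 0 -> M -> 0 exact. Finite sequences are those with
   C i = 0 for large i. *)
Record resolution M := Resolution {
  res_term : nat -> rmod R;
  res_diff : forall i, {linear res_term i.+1 -> res_term i};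
  res_aug : {linear res_term 0%N -> M};
  res_aug_surj : surj res_aug;
  res_exact0 : exact_at (res_diff 0%N) res_aug;
  res_exactS : forall i, exact_at (res_diff i.+1) (res_diff i)
}.

(* 0 -> M -> C 0 -> C 1 -> C 2 -> ... exact. *)
Record coresolution M := Coresolution {
  cores_term : nat -> rmod R;
  cores_diff : forall i, {linear cores_term i -> cores_term i.+1};
  cores_aug : {linear M -> cores_term 0%N};
  cores_aug_inj : injective cores_aug;
  cores_exact0 : exact_at cores_aug (cores_diff 0%N);
  cores_exactS : forall i, exact_at (cores_diff i) (cores_diff i.+1)
}.

Definition length_le (C : nat -> rmod R) (n : nat) : Prop :=
  forall i, (n < i)%N -> zero_module (C i).

Definition pd_le M (n : nat) : Prop :=
  exists r : resolution M,
    (forall i, projective (res_term r i)) /\ length_le (res_term r) n.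

Definition id_le M (n : nat) : Prop :=
  exists r : coresolution M,
    (forall i, injective_module (cores_term r i)) /\
    length_le (cores_term r) n.

(* Infimum of a set of natural numbers in nat with infinity; None stands for
   infinity, which is the infimum of the empty set. *)
Definition inf_nat (A : nat -> Prop) : option nat :=
  match pselect (exists n, `[< A n >]) with
  | left h => Some (ex_minn h)
  | right _ => None
  end.

(* The zero module gets dimension 0. *)
Definition pd M : option nat := inf_nat (pd_le M).

(* Supremum (least upper bound) of the finite projective dimensions of the
   modules in the class C. *)
Definition sup_pd (C : rmod R -> Prop) : option nat :=
  inf_nat (fun b => forall M d, C M -> pd M = Some d -> (d <= b)%N).

Definition fin_gen_projective_resolution M (r : resolution M) : Prop :=
  forall i, projective (res_term r i) /\ fin_gen (res_term r i).

(* Ext^(i.+1)(M, N) = 0, as the vanishing of the cohomology of Hom(C, N) in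
   degree i.+1 for a projective resolution C of M; the choice of C does not
   matter by the comparison theorem. *)
Definition ext_vanishes M N (i : nat) : Prop :=
  exists r : resolution M,
    (forall j, projective (res_term r j)) /\
    forall f : {linear res_term r i.+1 -> N},
      (forall x, f (res_diff r i.+1 x) = 0) ->
      exists g : {linear res_term r i -> N},
        forall x, f x = g (res_diff r i x).

(* M is in add U: a direct summand of a finite direct sum U ^ m. *)
Definition in_add (U M : rmod R) : Prop :=
  exists (m : nat) (s : {linear M -> {ffun 'I_m -> U}})
         (p : {linear {ffun 'I_m -> U} -> M}),
    forall x, p (s x) = x.

Definition tilting (U : rmod R) : Prop :=
  [/\ fin_gen U, exists n, pd_le U n, forall i, ext_vanishes U U i &
    exists (r : coresolution (regmod R)) (m : nat),
      (forall i, in_add U (cores_term r i)) /\ length_le (cores_term r) m].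

Section Stratification.
Variable n : nat.
Implicit Types (F L : 'I_n -> rmod R) (s : seq 'I_n).

Definition simple_representatives L : Prop :=
  [/\ forall i, simple_module (L i),
      forall i j, isomorphic (L i) (L j) -> i = j &
      forall S : rmod R, simple_module S -> exists i, isomorphic S (L i)].

(* M has a finite filtration whose subquotients, listed from the top, are
   isomorphic to F i for i in s. *)
Fixpoint filtered F M s : Prop :=
  match s with
  | [::] => zero_module M
  | i :: s' => exists (N : rmod R) (f : {linear N -> M})
                      (g : {linear M -> F i}),
                 short_exact f g /\ filtered F N s'
  end.

(* For F the family of simple modules L, s lists the composition factors of M
   with multiplicities, and up to order it is determined by M. *)
Definition factors_le L (i : 'I_n) M : Prop :=
  exists s, filtered L M s /\ all (fun j : 'I_n => j <= i)%N s.

Definition factor_once L (i : 'I_n) M : Prop :=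
  exists s, filtered L M s /\ count_mem i s = 1%N.

(* q : M -> N is the largest quotient of M with property C: every other such
   quotient is a quotient of it. *)
Definition largest_quotient (C : rmod R -> Prop) M N (q : {linear M -> N}) :
    Prop :=
  [/\ surj q, C N &
    forall (N' : rmod R) (q' : {linear M -> N'}), surj q' -> C N' ->
      exists h : {linear N -> N'}, forall x, q' x = h (q x)].

Definition properly_stratified L : Prop :=
  exists (P Delta PDelta : 'I_n -> rmod R)
         (p : forall i, {linear P i -> L i})
         (q : forall i, {linear P i -> Delta i})
         (r : forall i, {linear Delta i -> PDelta i}),
  [/\ forall i, projective_cover (p i),
      forall i, largest_quotient (factors_le L i) (q i),
      forall i, largest_quotient (factor_once L i) (r i),
      forall i, exists (K : rmod R) (f : {linear K -> P i}) (s : seq 'I_n),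
        [/\ short_exact f (q i), filtered Delta K s &
            all (fun j : 'I_n => i < j)%N s] &
      forall i, exists m, filtered PDelta (Delta i) (nseq m i)].

End Stratification.

Record fgmod := FgMod { fg_mod :> rmod R; fg_modP : fin_gen fg_mod }.

(* A contravariant functor on finitely generated modules which is exact, fixes
   the simple modules, and whose square is naturally isomorphic to the
   identity. *)
Record simple_preserving_duality := SimplePreservingDuality {
  dual_ob : fgmod -> fgmod;
  dual_map : forall A B : fgmod,
    {linear A -> B} -> {linear dual_ob B -> dual_ob A};
  dual_id : forall A : fgmod, dual_map (idfun : {linear A -> A}) =1 idfun;
  dual_comp : forall (A B C : fgmod) (f : {linear A -> B})
                     (g : {linear B -> C}),
    dual_map (g \o f : {linear A -> C}) =1 dual_map f \o dual_map g;
  dual_exact : forall (A B C : fgmod) (f : {linear A -> B})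
                      (g : {linear B -> C}),
    short_exact f g -> short_exact (dual_map g) (dual_map f);
  dual_unit : forall A : fgmod, {linear A -> dual_ob (dual_ob A)};
  dual_unit_bij : forall A : fgmod, bijective (dual_unit A);
  dual_unit_nat : forall (A B : fgmod) (f : {linear A -> B}),
    dual_map (dual_map f) \o dual_unit A =1 dual_unit B \o f;
  dual_simple : forall A : fgmod, simple_module A -> isomorphic (dual_ob A) A
}.

End Modules.

Definition Findim (R : nzRingType) : option nat := @sup_pd R (fun=> True).

Definition findim (R : nzRingType) : option nat :=
  @sup_pd R (fun M => exists r : resolution M, fin_gen_projective_resolution r).

(* Hom_k(R, k) with its right R-module structure (f r)(x) = f (r x). *)
Section Dual.
Variables (k : fieldType) (R : falgType k).

Definition kdual : Type := 'Hom(R, k^o).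

HB.instance Definition _ := GRing.Zmodule.on kdual.

Definition kdual_act (r : R^c) (f : kdual) : kdual :=
  ((f : 'Hom(R, k^o)) \o amull (r : R))%VF.

Fact kdual_actA a b f : kdual_act a (kdual_act b f) = kdual_act (a * b) f.
Proof. by apply/lfunP=> x; rewrite !lfunE /= !lfunE /= !lfunE /= mulrA. Qed.

Fact kdual_act1 : left_id 1 kdual_act.
Proof. by move=> f; apply/lfunP=> x; rewrite !lfunE /= lfunE /= mul1r. Qed.

Fact kdual_actDr : right_distributive kdual_act +%R.
Proof.
by move=> a f g; apply/lfunP=> x; rewrite [RHS]lfunE /= !lfunE /= add_lfunE.
Qed.

Fact kdual_actDl f : {morph kdual_act^~ f : a b / a + b}.
Proof.
move=> a b; apply/lfunP=> x.
by rewrite [RHS]lfunE /= !lfunE /= !lfunE /= mulrDl linearD.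
Qed.

HB.instance Definition _ :=
  GRing.Zmodule_isLmodule.Build R^c kdual
    kdual_actA kdual_act1 kdual_actDr kdual_actDl.

Definition cotilting (U : rmod R) : Prop :=
  [/\ fin_gen U, exists n, id_le U n, forall i, ext_vanishes U U i &
    exists (r : resolution (kdual : rmod R)) (m : nat),
      (forall i, in_add U (res_term r i)) /\ length_le (res_term r) m].

End Dual.

(* Main.v *)
From HB Require Import structures.
From mathcomp Require Import all_boot all_order all_algebra all_field.
From mathcomp Require Import boolp classical_sets functions.
Require Import Defs.

(* The regular module R_R is tilting, hence cotilting: it has finite injective
   dimension d, and D = Hom_k(R, k) has a finite resolution by finitely
   generated projectives. So pd D is bounded by findim R; let b be such a
   bound. For a power F = R^X, Ext^i(-, F) vanishes for i > d. Every module
   embeds in a power D^Y, and pd D^Y <= b, so dimension shifting along these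
   embeddings shows that Ext^i(-, F) vanishes already for i > b. As every
   projective is a direct summand of some R^X, the last map of a projective
   resolution of length > b splits, so a module of finite projective dimension
   has projective dimension at most b. *)

Set Implicit Arguments.
Unset Strict Implicit.
Unset Printing Implicit Defensive.

Import GRing.Theory.
Local Open Scope ring_scope.

(** * Linear maps, submodules and factorization *)

Section LinearMaps.
Variable A : nzRingType.
Implicit Types M N P Q : lmodType A.

Lemma linear_realizable M N (f : M -> N) :
  linear f -> exists g : {linear M -> N}, forall x, g x = f x.
Proof.
move=> lf; pose h := GRing.isLinear.Build A M N *:%R f lf.
by exists (HB.pack f h : {linear M -> N}).
Qed.

Section Submodule.
Variables (M : lmodType A) (S : {pred M}).
Hypothesis S_submod : submod_closed S.

Let closed_mixin := GRing.isSubmodClosed.Build A M S (GRing.submod_closed_semi S_submod).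
Let S' : submodClosed M := HB.pack S closed_mixin.

Record submodule := Submodule { submodule_val :> M; _ : submodule_val \in S' }.
HB.instance Definition _ := [isSub for submodule_val].
HB.instance Definition _ := [Choice of submodule by <:].
HB.instance Definition _ := [SubChoice_isSubLmodule of submodule by <:].
End Submodule.

Lemma submodule_realizable M (S : M -> Prop) :
  S 0 -> (forall a x y, S x -> S y -> S (a *: x + y)) ->
  exists (N : lmodType A) (i : {linear N -> M}),
    injective i /\ forall x, S x <-> exists y, i y = x.
Proof.
move=> S0 SZD; pose T : {pred M} := fun x => `[< S x >].
have TP : submod_closed T.
  split=> [|a x y /asboolP Sx /asboolP Sy]; apply/asboolP => //.
  exact: SZD.
exists (submodule TP), (val : {linear submodule TP -> M}); split; first exact: val_inj.
move=> x; split=> [Sx|[y <-]]; last by apply/asboolP; exact: (valP y).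
have Tx : x \in T by apply/asboolP.
by exists (@Submodule _ _ TP x Tx).
Qed.

Lemma factor_injective M N P (i : {linear N -> M}) (h : {linear P -> M}) :
  injective i -> (forall x, exists y, i y = h x) ->
  exists h' : {linear P -> N}, forall x, i (h' x) = h x.
Proof.
move=> inji /choice[h' h'E].
have [|g gE] := @linear_realizable _ _ h'.
  by move=> a x y; apply: inji; rewrite linearP !h'E linearP.
by exists g => x; rewrite gE.
Qed.

Lemma factor_surjective M N P (p : {linear M -> N}) (h : {linear M -> P}) :
  surj p -> (forall x, p x = 0 -> h x = 0) ->
  exists h' : {linear N -> P}, forall x, h' (p x) = h x.
Proof.
move=> /choice[s sE] ker_ph.
have hE x y : p x = p y -> h x = h y.
  move/eqP; rewrite -subr_eq0 -linearB => /eqP/ker_ph/eqP.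
  by rewrite linearB subr_eq0 => /eqP.
have [|g gE] := @linear_realizable _ _ (h \o s).
  by move=> a x y; rewrite /= -linearP; apply: hE; rewrite linearP !sE.
by exists g => x; rewrite gE; apply: hE; rewrite sE.
Qed.

(** The scalar -1 gives differences of pairs, so triviality over 0 makes the relation single-valued,
    hence a graph. *)
Lemma scalar_closed_relation_realizable M N (G : M -> N -> Prop) :
  (forall a x y u v, G x u -> G y v -> G (a *: x + y) (a *: u + v)) ->
  (forall u, G 0 u -> u = 0) -> (forall x, exists u, G x u) ->
  exists h : {linear M -> N}, forall x u, G x u <-> h x = u.
Proof.
move=> GZD G0 /choice[h hG].
have uniqG x u v : G x u -> G x v -> u = v.
  move=> Gu Gv; apply/eqP; rewrite eq_sym -subr_eq0 addrC -scaleN1r; apply/eqP/G0.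
  by rewrite -(addNr x) -scaleN1r; apply: GZD.
have [|g gE] := @linear_realizable _ _ h.
  by move=> a x y; apply: (uniqG (a *: x + y)) => //; apply: GZD.
by exists g => x u; rewrite gE; split=> [Gu|<- //]; apply: (uniqG x).
Qed.
End LinearMaps.

(** * Extension of linear relations over a field by Zorn's lemma *)

Section LinearExtension.
Local Open Scope classical_set_scope.
Variables (k : fieldType) (B W : lmodType k).
Implicit Types S G T : set (B * W).

Definition linear_relation S :=
  S 0 /\ forall c p q, S p -> S q -> S (c *: p + q).

(** A maximal linear relation inside [T] that contains [G] and is trivial over 0 is defined
    everywhere, hence is a graph. With [T] everything, this extends the partial map [G]; with [G]
    zero, it chooses a linear section of [T]. *)
Lemma linear_extension T G :
  linear_relation T -> linear_relation G -> G `<=` T ->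
  (forall w, G (0, w) -> w = 0) -> (forall b, exists w, T (b, w)) ->
  exists h : {linear B -> W},
    (forall b, T (b, h b)) /\ forall b w, G (b, w) -> h b = w.
Proof.
move=> [T0 TL] linG GT G0 Ttot.
pose good S := [/\ linear_relation S, S `<=` T & forall w, S (0, w) -> w = 0].
(* The order is on [S] alone and [G] is adjoined in the condition: the empty chain then causes no
   trouble, because [G] itself is good. *)
have [F FP Fchain|S [[linS ST S0] Smax]] :=
    @Zorn_bigcup _ [set S | good (S `|` G)].
  have [->|/set0P[S1 FS1]] := eqVneq F set0.
    by rewrite /= bigcup_set0 set0U.
  have chain p q : (\bigcup_(X in F) X `|` G) p -> (\bigcup_(X in F) X `|` G) q ->
      exists2 X, F X & (X `|` G) p /\ (X `|` G) q.
    move=> [[X FX Xp]|Gp] [[Y FY Yq]|Gq].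
    - by have [XY|YX] := Fchain _ _ FX FY; [exists Y|exists X] => //; split; left => //;
        [apply: XY|apply: YX].
    - by exists X => //; split; [left|right].
    - by exists Y => //; split; [right|left].
    - by exists S1 => //; split; right.
  split.
  - split=> [|c p q Up Uq]; first by right; apply: linG.1.
    have [X FX [Xp Xq]] := chain _ _ Up Uq.
    have [[_ XL] _ _] := FP _ FX.
    by case: (XL c _ _ Xp Xq) => [?|?]; [left; exists X|right].
  - by move=> p /(fun Up => chain _ _ Up Up)[X /FP[_ XT _] [/XT]].
  - by move=> w /(fun Up => chain _ _ Up Up)[X /FP[_ _ X0] [/X0]].
set S' := S `|` G in linS ST S0.
have S'tot b : exists w, S' (b, w).
  (* If [b] were outside the domain, adjoining the line through a pair [(b, w)] of [T] would give a
     strictly larger good relation. *)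
  apply: contrapT => S'b; have [w Tbw] := Ttot b.
  pose N : set (B * W) := [set p | exists c q, S' q /\ p = c *: (b, w) + q].
  have S'N : S' `<=` N by move=> q S'q; exists 0, q; rewrite scale0r add0r.
  apply: (Smax N).
    split; first by move=> q Sq; apply: S'N; left.
    move=> /(_ (b, w)) NS; apply: S'b; exists w; left; apply: NS.
    by exists 1, 0; split; [exact: linS.1|rewrite scale1r addr0].
  rewrite /=; have -> : N `|` G = N.
    by apply/seteqP; split=> [q [//|Gq]|q]; [apply: S'N; right|left].
  split.
  - split=> [|c _ _ [c1 [q1 [Sq1 ->]]] [c2 [q2 [Sq2 ->]]]]; first exact/S'N/linS.1.
    exists (c * c1 + c2), (c *: q1 + q2); split; first exact: linS.2.
    by rewrite scalerDr scalerA scalerDl -!addrA; congr (_ + _); rewrite addrCA.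
  - by move=> _ [c [q [Sq ->]]]; apply: TL => //; apply: ST.
  (* A nonzero [c] would make [b] a multiple of [b'], which lies in the domain of [S']. *)
  - move=> w' [c [[b' u] [Sq [/esym cb ->]]]].
    have [c0|c0] := eqVneq c 0.
      by move: cb Sq; rewrite c0 !scale0r !add0r => -> /S0.
    case: S'b; exists (- c^-1 *: u).
    have -> : (b, - c^-1 *: u) = (- c^-1) *: (b', u) + 0.
      have /eqP := cb; rewrite /= addrC addr_eq0 => /eqP b'E.
      rewrite addr0; congr (_, _).
      by rewrite /= b'E scaleNr scalerN opprK scalerA mulVf ?scale1r.
    by apply: linS.2 => //; apply: linS.1.
have [|h hE] :=
  @scalar_closed_relation_realizable _ _ _ (fun x u => S' (x, u)) _ S0 S'tot.
  by move=> a x y u v; apply: linS.2.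
exists h; split=> [b|b w Gbw]; first by apply/ST/hE.
by apply/hE; right.
Qed.
End LinearExtension.

(** * Exactness, powers of modules and syzygies *)

Section Homological.
Variable R : nzRingType.
Implicit Types (M N P Q I C K : rmod R) (X : Type).

Lemma kernel_realizable M N (f : {linear M -> N}) :
  exists (K : rmod R) (i : {linear K -> M}), injective i /\ exact_at i f.
Proof.
apply: submodule_realizable => [|a x y fx fy]; first exact: linear0.
by rewrite linearP fx fy scaler0 addr0.
Qed.

Lemma image_realizable M N (f : {linear M -> N}) :
  exists (C : rmod R) (i : {linear C -> N}) (p : {linear M -> C}),
    [/\ injective i, surj p & forall x, i (p x) = f x].
Proof.
have [||C [i [inji iE]]] := @submodule_realizable _ N (fun y => exists x, f x = y).
- by exists 0; rewrite linear0.
- by move=> a _ _ [x <-] [y <-]; exists (a *: x + y); rewrite linearP.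
have [|p pE] := factor_injective (h := f) inji; first by move=> x; apply/iE; exists x.
exists C, i, p; split=> // c; have /iE[x fx] : exists y, i y = i c by exists c.
by exists x; apply: inji; rewrite pE.
Qed.

Lemma projective_lift_exact P M N C (f : {linear M -> N}) (g : {linear N -> C})
    (h : {linear P -> N}) :
  projective P -> exact_at f g -> (forall x, g (h x) = 0) ->
  exists s : {linear P -> M}, forall x, f (s x) = h x.
Proof.
move=> projP fg gh0; have [K [i [p [inji surjp ip]]]] := image_realizable f.
have [|h' h'E] := factor_injective (h := h) inji.
  by move=> x; have /fg[y <-] := gh0 x; exists (p y).
by have [s sE] := projP _ _ _ h' surjp; exists s => x; rewrite -ip sE h'E.
Qed.

Lemma projective_retract P Q (s : {linear Q -> P}) (p : {linear P -> Q}) :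
  cancel s p -> projective P -> projective Q.
Proof.
move=> sK projP M N g f surjg.
have [h hE] := projP _ _ g (f \o p : {linear P -> N}) surjg.
by exists (h \o s : {linear Q -> M}) => x; rewrite /= hE /= sK.
Qed.

Lemma zero_projective Q : zero_module Q -> projective Q.
Proof.
by move=> Q0 M N g f surjg; exists \0 => x; rewrite (Q0 x) !linear0.
Qed.

Definition pi_map X M N (f : {linear M -> N}) (u : X -> M) : X -> N :=
  fun x => f (u x).

Fact pi_map_linear X M N (f : {linear M -> N}) : linear (@pi_map X M N f).
Proof. by move=> a u v; apply/funext => x; rewrite /pi_map linearP. Qed.

HB.instance Definition _ X M N (f : {linear M -> N}) :=
  GRing.isLinear.Build R^c (X -> M) (X -> N) *:%R (@pi_map X M N f)
    (@pi_map_linear X M N f).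

Lemma pi_map_inj X M N (f : {linear M -> N}) :
  injective f -> injective (@pi_map X _ _ f).
Proof.
by move=> injf u v uv; apply/funext => x; apply: injf; exact: (congr1 (@^~ x) uv).
Qed.

Lemma pi_map_surj X M N (f : {linear M -> N}) :
  surj f -> surj (@pi_map X _ _ f).
Proof. by move=> /choice[s sE] v; exists (s \o v); apply/funext => x; exact: sE. Qed.

Lemma pi_map_exact X M N C (f : {linear M -> N}) (g : {linear N -> C}) :
  exact_at f g -> exact_at (@pi_map X _ _ f) (@pi_map X _ _ g).
Proof.
move=> fg v; split=> [gv0|[u <-]]; last by apply/funext => x; apply/fg; exists (u x).
have /choice[u uE] x : exists y, f y = v x by apply/fg; exact: (congr1 (@^~ x) gv0).
by exists u; apply/funext.
Qed.

Lemma injective_pi X I : injective_module I -> injective_module (X -> I : rmod R).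
Proof.
move=> injI M N g f injg.
have /choice[h hE] x : exists h : {linear N -> I}, forall y, h (g y) = f y x.
  have [|fx fxE] := @linear_realizable _ _ _ (fun y => f y x).
    by move=> a u v; rewrite linearP.
  by have [h hE] := injI _ _ g fx injg; exists h => y; rewrite hE fxE.
have [|h' h'E] := @linear_realizable _ N (X -> I : rmod R) (fun y x => h x y).
  by move=> a u v; apply/funext => x; rewrite linearP.
by exists h' => y; rewrite h'E; apply/funext => x; exact: hE.
Qed.

(** Powers preserve exactness and injectivity, so one injective coresolution of the regular module
    serves all its powers, with the same bound on the length. *)
Definition coresolution_pi X M (c : coresolution M) : coresolution (X -> M : rmod R) :=
  @Coresolution _ (X -> M : rmod R) (fun i => (X -> cores_term c i : rmod R))
    (fun i => @pi_map X _ _ (cores_diff c i)) (@pi_map X _ _ (cores_aug c))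
    (pi_map_inj (@cores_aug_inj _ _ c)) (pi_map_exact (@cores_exact0 _ _ c))
    (fun i => pi_map_exact (@cores_exactS _ _ c i)).

(** Projective dimension at most [m], in the form of [m] successive syzygies ending in a projective
    one. This suits induction by dimension shifting; it is equivalent to [pd_le], as shown below. *)
Fixpoint syzygy_projective (m : nat) M : Prop :=
  if m is m'.+1 then
    exists K P (i : {linear K -> P}) (p : {linear P -> M}),
      [/\ short_exact i p, projective P & syzygy_projective m' K]
  else projective M.

Lemma syzygy_projective_pi X m M :
  (forall P, projective P -> projective (X -> P : rmod R)) ->
  syzygy_projective m M -> syzygy_projective m (X -> M : rmod R).
Proof.
move=> proj_pi; elim: m M => [|m IHm] M; first exact: proj_pi.
move=> [K [P [i [p [[inji ip surjp] projP Km]]]]].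
exists (X -> K : rmod R), (X -> P : rmod R), (@pi_map X _ _ i), (@pi_map X _ _ p).
split; [|exact: proj_pi|exact: IHm].
by split; [exact: pi_map_inj|exact: pi_map_exact|exact: pi_map_surj].
Qed.

Lemma pd_le_syzygy m M : pd_le M m -> syzygy_projective m M.
Proof.
elim: m M => [|m IHm] M [r [proj_r len_r]].
  (* The term of degree 1 is zero, so the augmentation is injective and [s] is its inverse. *)
  have [|s sE] := factor_surjective (h := idfun) (@res_aug_surj _ _ r).
    by move=> x /res_exact0[y <-]; rewrite (len_r 1%N isT y) linear0.
  apply: (projective_retract (s := s) (p := res_aug r)); last exact: proj_r.
  by move=> x; have [y <-] := @res_aug_surj _ _ r x; rewrite sE.
have [K [i [inji iE]]] := kernel_realizable (res_aug r).
(* Corestricted to the kernel [K], the first differential becomes the augmentation of the shifted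
   resolution. *)
have [|d dE] := factor_injective (h := res_diff r 0%N) inji.
  by move=> x; apply/iE/res_exact0; exists x.
exists K, (res_term r 0%N), i, (res_aug r); split; [|exact: proj_r|].
  by split=> //; exact: res_aug_surj.
apply: IHm.
have surj_d : surj d.
  move=> y; have /res_exact0[x xE] : res_aug r (i y) = 0 by apply/iE; exists y.
  by exists x; apply: inji; rewrite dE.
have exact_d : exact_at (res_diff r 1%N) d.
  move=> x; rewrite -(@res_exactS _ _ r 0%N x) -dE; split=> [->|]; first exact: linear0.
  by rewrite -[in X in _ = X -> _](linear0 i) => /inji.
exists (Resolution surj_d exact_d (fun j => @res_exactS _ _ r j.+1)).
by split=> [j|j jm]; [exact: proj_r|exact: len_r].
Qed.

Lemma zero_module_exists : exists Z : rmod R, zero_module Z.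
Proof.
by exists 'rV[R^c]_0 => x; apply/rowP => -[].
Qed.

Lemma syzygy_pd_le m M : syzygy_projective m M -> pd_le M m.
Proof.
elim: m M => [|m IHm] M.
  move=> projM; have [Z Z0] := zero_module_exists.
  pose t i : rmod R := if i is 0%N then M else Z.
  pose d i : {linear t i.+1 -> t i} := \0.
  have surj_aug : surj (idfun : {linear t 0%N -> M}) by move=> x; exists x.
  have exact_aug : exact_at (d 0%N) (idfun : {linear t 0%N -> M}).
    by move=> x; split=> [x0|[y <-] //]; exists 0.
  have exact_d i : exact_at (d i.+1) (d i).
    by move=> x; split=> // _; exists 0; rewrite (Z0 x).
  exists (Resolution surj_aug exact_aug exact_d); split=> [[|i]|[|i] //] //=.
  exact: zero_projective.
move=> [K [P [i [p [[inji ip surjp] projP /IHm[r [proj_r len_r]]]]]]].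
(* The resolution of [K] is spliced onto [P]; the new first differential is its augmentation
   followed by the inclusion of [K]. *)
pose t j : rmod R := if j is j'.+1 then res_term r j' else P.
pose d j : {linear t j.+1 -> t j} :=
  match j with 0%N => (i \o res_aug r : {linear _ -> _}) | j'.+1 => res_diff r j' end.
have exact_aug : exact_at (d 0%N) p.
  move=> x; rewrite (ip x); split=> -[y <-]; last by exists (res_aug r y).
  by have [z <-] := @res_aug_surj _ _ r y; exists z.
have exact_d j : exact_at (d j.+1) (d j).
  case: j => [|j]; last exact: res_exactS.
  move=> x; rewrite -(@res_exact0 _ _ r x) /=; split=> [|->]; last exact: linear0.
  by rewrite -[in X in _ = X -> _](linear0 i) => /inji.
exists (Resolution surjp exact_aug exact_d); split=> [[|j]|[|j] //] //.
  exact: proj_r.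
exact: len_r.
Qed.

(* [Ext^(i.+1)(M, F) = 0], computed from the coresolution [c] of [F]. *)
Definition coext_vanishes F (c : coresolution F) (i : nat) M : Prop :=
  forall f : {linear M -> cores_term c i.+1},
    (forall x, cores_diff c i.+1 (f x) = 0) ->
    exists g : {linear M -> cores_term c i}, forall x, f x = cores_diff c i (g x).

(** * Dimension shifting for Ext computed from an injective coresolution *)

Section Coext.
Variables (F : rmod R) (c : coresolution F).
Hypothesis inj_c : forall i, injective_module (cores_term c i).

Let diffK i x : cores_diff c i.+1 (cores_diff c i x) = 0.
Proof. by apply/cores_exactS; exists x. Qed.

Lemma coext_vanishes_length d i M :
  length_le (cores_term c) d -> (d <= i)%N -> coext_vanishes c i M.
Proof.
move=> len_c di f _; exists \0 => x.
by rewrite (len_c i.+1 _ (f x)) ?linear0.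
Qed.

Lemma coext_vanishes_projective i P : projective P -> coext_vanishes c i P.
Proof.
move=> projP f f0; have [s sE] := projective_lift_exact projP (@cores_exactS _ _ c i) f0.
by exists s.
Qed.

Section LongExact.
Variables (M N C : rmod R) (i : {linear M -> N}) (p : {linear N -> C}).
Hypothesis ex_ip : short_exact i p.

Let inji : injective i. Proof. by case: ex_ip. Qed.
Let exip : exact_at i p. Proof. by case: ex_ip. Qed.
Let surjp : surj p. Proof. by case: ex_ip. Qed.
Let pi0 x : p (i x) = 0. Proof. by apply/exip; exists x. Qed.

(** Exactness of Ext^(j+1)(N, F) -> Ext^(j+1)(M, F) -> Ext^(j+2)(C, F) at the middle term. *)
Lemma coext_vanishes_sub j :
  coext_vanishes c j N -> coext_vanishes c j.+1 C -> coext_vanishes c j M.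
Proof.
move=> VN VC f f0; have [h hE] := inj_c f inji.
have [|q qE] := factor_surjective (h := cores_diff c j.+1 \o h) surjp.
  by move=> x /exip[y <-] /=; rewrite hE.
have [|u uE] := VC q; first by move=> x; have [y <-] := surjp x; rewrite qE /= diffK.
(* Subtracting [u \o p] turns the extension [h] into a cocycle without changing it on [M]. *)
have [|v vE] := VN (h \- (u \o p : {linear N -> _})).
  by move=> x; rewrite /= linearB /= -uE qE /= subrr.
exists (v \o i) => x; rewrite /= -vE /= pi0 linear0 subr0 hE //.
Qed.

(** Exactness of Ext^(j+1)(M, F) -> Ext^(j+2)(C, F) -> Ext^(j+2)(N, F) at the middle term. *)
Lemma coext_vanishes_quotient j :
  coext_vanishes c j M -> coext_vanishes c j.+1 N -> coext_vanishes c j.+1 C.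
Proof.
move=> VM VN f f0; have [|h hE] := VN (f \o p : {linear N -> _}).
  by move=> x; rewrite /= f0.
have [|g gE] := VM (h \o i : {linear M -> _}).
  by move=> x; rewrite /= -hE /= pi0 linear0.
(* Once the coboundary of an extension of [g] is subtracted, [h] vanishes on [M] and descends to
   [C]. *)
have [g' g'E] := inj_c g inji.
have [|u uE] :=
  factor_surjective (h := h \- (cores_diff c j \o g' : {linear N -> _})) surjp.
  by move=> x /exip[y <-] /=; rewrite g'E -gE /= subrr.
by exists u => x; have [y <-] := surjp x; rewrite uE /= linearB /= diffK subr0 -hE.
Qed.

(** The obstruction to extending [s] lies in Ext^1(C, F). The extension is first made into the
    injective term of degree 0, then corrected so that its values lie in [F]. *)
Lemma coext_vanishes_extend (s : {linear M -> F}) :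
  coext_vanishes c 0%N C -> exists h : {linear N -> F}, forall x, h (i x) = s x.
Proof.
move=> VC; have [h hE] := inj_c (cores_aug c \o s : {linear M -> _}) inji.
have aug0 x : cores_diff c 0%N (cores_aug c x) = 0 by apply/cores_exact0; exists x.
have [|q qE] := factor_surjective (h := cores_diff c 0%N \o h) surjp.
  by move=> x /exip[y <-] /=; rewrite hE /= aug0.
have [|u uE] := VC q; first by move=> x; have [y <-] := surjp x; rewrite qE /= diffK.
have [|g gE] := factor_injective (h := h \- (u \o p : {linear N -> _}))
                                 (@cores_aug_inj _ _ c).
  by move=> x; apply/cores_exact0; rewrite /= linearB /= -uE qE /= subrr.
exists g => x; apply: (@cores_aug_inj _ _ c).
by rewrite gE /= pi0 linear0 subr0 hE.
Qed.
End LongExact.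

Lemma coext_vanishes_syzygy m i M :
  syzygy_projective m M -> (m <= i)%N -> coext_vanishes c i M.
Proof.
elim: m i M => [|m IHm] i M; first by move=> projM _; exact: coext_vanishes_projective.
move=> [K [P [f [g [fg projP Km]]]]]; case: i => // i mi.
apply: (coext_vanishes_quotient fg); last exact: coext_vanishes_projective.
exact: IHm.
Qed.
End Coext.

(** For [m] zero, the kernel [K] is a summand of some [F t]; vanishing of Ext^1 extends its
    inclusion to [P], so [K] splits off. For larger [m], vanishing of Ext^(m+1)(M, F) passes to
    Ext^m(K, F). *)
Lemma resolution_length_drop (T : Type) (F : T -> rmod R)
    (c : forall t, coresolution (F t)) :
  (forall t i, injective_module (cores_term (c t) i)) ->
  (forall P, projective P -> exists t (s : {linear P -> F t}) (p : {linear F t -> P}),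
    cancel s p) ->
  forall m M, syzygy_projective m.+1 M -> (forall t, coext_vanishes (c t) m M) ->
    syzygy_projective m M.
Proof.
move=> inj_c retr; elim=> [|m IHm] M.
  move=> [K [P [i [p [ip projP projK]]]]] VM.
  have [t [s [q sK]]] := retr K projK.
  have [h hE] := coext_vanishes_extend (inj_c t) ip s (VM t).
  case: (ip) => inji exip surjp.
  (* The projection of [P] complementary to [K] kills [K], so it descends to a section [u] of
     [p]. *)
  have [|u uE] :=
    factor_surjective (h := idfun \- (i \o (q \o h : {linear P -> K})
                                        : {linear P -> P})) surjp.
    move=> x /exip[y <-] /=.
    by rewrite hE sK subrr.
  apply: (projective_retract (s := u) (p := p)) projP => x.
  have [y <-] := surjp x; rewrite uE /= linearB /=.
  by rewrite -[RHS]subr0; congr (_ - _); apply/exip; eexists.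
move=> [K [P [i [p [ip projP Km]]]]] VM.
exists K, P, i, p; split=> //; apply: IHm => // t.
apply: (coext_vanishes_sub (inj_c t) ip); last exact: VM.
exact: coext_vanishes_projective.
Qed.

End Homological.

Lemma sum_sub_uniq (T : eqType) (V : nmodType) (F : T -> V) (s t : seq T) :
  uniq s -> uniq t -> {subset s <= t} ->
  (forall x, x \in t -> x \notin s -> F x = 0) ->
  \sum_(x <- s) F x = \sum_(x <- t) F x.
Proof.
move=> us ut st F0; rewrite [RHS](bigID (mem s)) /= [X in _ = _ + X]big1_seq.
  rewrite addr0 -[RHS]big_filter; apply: perm_big; apply: uniq_perm => //.
    exact: filter_uniq.
  by move=> x; rewrite mem_filter; case: (boolP (x \in s)) => // /st.
by move=> x /andP[xs xt]; exact: F0.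
Qed.

(** * Modules over a finite dimensional algebra *)

Section Restriction.
Variables (k : fieldType) (R : falgType k).

(* Restriction of scalars along k -> R. *)
Definition restriction (M : rmod R) : Type := M.

Section RestrictionModule.
Variable M : rmod R.

HB.instance Definition _ := GRing.Zmodule.on (restriction M).

Definition restriction_scale (c : k) (x : restriction M) : restriction M :=
  ((c%:A : R) : R^c) *: (x : M).

Fact restriction_scaleA a b x :
  restriction_scale a (restriction_scale b x) = restriction_scale (a * b) x.
Proof.
rewrite /restriction_scale scalerA; congr (_ *: _).
by rewrite [LHS]mulr_algl scalerA mulrC.
Qed.

Fact restriction_scale1 : left_id 1 restriction_scale.
Proof. by move=> x; rewrite /restriction_scale scale1r scale1r. Qed.

Fact restriction_scaleDr : right_distributive restriction_scale +%R.
Proof. by move=> a x y; apply: scalerDr. Qed.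

Fact restriction_scaleDl x : {morph restriction_scale^~ x : a b / a + b}.
Proof. by move=> a b; rewrite /restriction_scale [X in X *: _]scalerDl scalerDl. Qed.

HB.instance Definition _ := GRing.Zmodule_isLmodule.Build k (restriction M)
  restriction_scaleA restriction_scale1 restriction_scaleDr restriction_scaleDl.
End RestrictionModule.

Lemma linear_restrict (M N : rmod R) (f : {linear M -> N}) :
  linear (f : restriction M -> restriction N).
Proof. by move=> c x y; rewrite linearD; congr (_ + _); exact: (linearZZ f). Qed.

(** * Powers of the regular module as induced modules *)

Section FreeProduct.
Variable X : Type.
Let F : rmod R := X -> regmod R.
Let V : lmodType k := X -> k^o.
Let e (i : 'I_(\dim {:R})) : R := (vbasis {:R})`_i.
Let crd (i : 'I_(\dim {:R})) : {linear R -> k^o} := coord (vbasis {:R}) i.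

Let crdE (r : R) : r = \sum_i crd i r *: e i.
Proof. by rewrite [LHS](coord_vbasis (memvf r)). Qed.

Let crdF i (f : F) : V := fun x => crd i (f x : R).
Let cst_mul (v : V) : F := fun x => (v x)%:A : R.

(** A finite basis of [R] splits [f] into finitely many k-valued functions, so k^X generates R^X
    even when [X] is infinite. *)
Let decompose (f : F) : f = \sum_i (e i : R^c) *: cst_mul (crdF i f).
Proof.
apply/funext => x; rewrite fct_sumE [LHS]crdE; apply: eq_bigr => i _.
by rewrite -[RHS]/((_ %:A : R) * e i) mulr_algl.
Qed.

Lemma free_pi_hom_ext (M : rmod R) (f g : {linear F -> M}) :
  (forall v, f (cst_mul v) = g (cst_mul v)) -> f =1 g.
Proof.
move=> fg u; rewrite (decompose u) !linear_sum; apply: eq_bigr => i _.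
by rewrite !linearZ fg.
Qed.

(* As R is finite dimensional, R^X is k^X tensored with R, hence induced. *)
Lemma free_pi_hom (M : rmod R) (rho : {linear V -> restriction M}) :
  exists h : {linear F -> M}, forall v, h (cst_mul v) = rho v.
Proof.
pose h (f : F) : M := \sum_i (e i : R^c) *: (rho (crdF i f) : M).
have hD f g : h (f + g) = h f + h g.
  rewrite /h -big_split; apply: eq_bigr => i _ /=.
  rewrite -scalerDr; congr (_ *: _).
  by rewrite -[RHS]linearD; congr (rho _); apply/funext => x; apply: linearD.
have hZ a f : h (a *: f) = a *: h f.
  rewrite /h scaler_sumr.
  under [RHS]eq_bigr => j _ do rewrite scalerA.
  (* Each product of [e j] with [a] is expanded in the basis; exchanging the sums reassembles it. *)
  transitivity (\sum_i \sum_j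
    ((crd i (e j * (a : R)) *: e i : R) : R^c) *: (rho (crdF j f) : M)).
    apply: eq_bigr => i _.
    have -> : crdF i (a *: f) = \sum_j crd i (e j * (a : R)) *: crdF j f.
      apply/funext => x; rewrite fct_sumE /crdF.
      rewrite -[(a *: f) x]/((f x : R) * (a : R)) {1}[f x : R]crdE mulr_suml linear_sum.
      apply: eq_bigr => j _; rewrite -scalerAl linearZ /=.
      exact: mulrC.
    rewrite linear_sum scaler_sumr; apply: eq_bigr => j _.
    rewrite linearZ /= -[_ *: rho _]/(((_ %:A : R) : R^c) *: (rho _ : M)) scalerA.
    by congr (_ *: _); rewrite -[LHS]/((_ %:A : R) * e i) mulr_algl.
  rewrite exchange_big /=; apply: eq_bigr => j _.
  rewrite -scaler_suml; congr (_ *: _).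
  by rewrite -[RHS]/(e j * (a : R)) [RHS]crdE.
have [|g gE] := @linear_realizable _ _ _ h.
  by move=> a x y; rewrite hD hZ.
exists g => v; rewrite gE /h.
(* The coordinates of [cst_mul v] are those of 1 times [v], and they recombine to 1. *)
transitivity (\sum_i ((crd i 1 *: e i : R) : R^c) *: (rho v : M)).
  apply: eq_bigr => i _.
  have -> : crdF i (cst_mul v) = crd i 1 *: v.
    by apply/funext => x; rewrite /crdF /cst_mul linearZ; exact: mulrC.
  rewrite linearZ /= -[_ *: rho _]/(((_ %:A : R) : R^c) *: (rho _ : M)) scalerA.
  by congr (_ *: _); rewrite -[LHS]/((_ %:A : R) * e i) mulr_algl.
by rewrite -scaler_suml -crdE scale1r.
Qed.

(** Maps out of R^X are determined by k-linear maps out of k^X, so a lift need only be chosen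
    k-linearly there: a linear section of the relation [T]. *)
Lemma free_pi_projective : projective F.
Proof.
move=> M N g f surjg.
pose T : set (V * restriction M) :=
  [set p : V * restriction M | g p.2 = f (cst_mul p.1)]%classic.
have cst_mulP c u v : cst_mul (c *: u + v) = ((c%:A : R) : R^c) *: cst_mul u + cst_mul v.
  apply/funext => x; rewrite /cst_mul [LHS]scalerDl; congr (_ + _).
  by rewrite -[RHS]/((_ %:A : R) * (_ %:A : R)) mulr_algl scalerA mulrC.
have cst_mul0 : cst_mul 0 = 0 by apply/funext => x; exact: (scale0r (1 : R)).
have [|||||rho [rhoT _]] := @linear_extension k V (restriction M) T [set 0]%classic.
- split=> [|c p q]; rewrite /T /=.
    by rewrite cst_mul0 !linear0.
  by move=> gp gq; rewrite cst_mulP linearP gp gq -linearP.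
- by split=> // c _ _ -> ->; rewrite /= scaler0 addr0.
- by move=> _ ->; rewrite /T /= cst_mul0 !linear0.
- by move=> w [].
- by move=> v; have [m mE] := surjg (f (cst_mul v)); exists m.
have [h hE] := free_pi_hom rho; exists h.
apply: (@free_pi_hom_ext _ (g \o h : {linear F -> N})) => v /=.
by rewrite hE; exact: rhoT.
Qed.
End FreeProduct.

(* The partial map from k^M to M sending each indicator of a point m to m is
   extended linearly. *)
Lemma free_pi_generates (M : rmod R) :
  exists (X : Type) (p : {linear (X -> regmod R) -> M}), surj p.
Proof.
pose supported (v : M -> k^o) (s : seq M) := uniq s /\ forall x, v x != 0 -> x \in s.
pose comb (v : M -> k^o) (s : seq M) : restriction M :=
  \sum_(x <- s) v x *: (x : restriction M).
have combE v s t :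
    supported v s -> supported v t -> {subset s <= t} -> comb v s = comb v t.
  move=> [us vs] [ut _] st; apply: sum_sub_uniq => // x _ /negP xs.
  have -> : v x = 0 by apply/eqP/negP => /negP/vs.
  exact: scale0r.
(* The list [s] may exceed the support, so two functions can be summed over a common list. *)
pose G : set ((M -> k^o) * restriction M) :=
  [set p : (M -> k^o) * restriction M |
     exists2 s, supported p.1 s & p.2 = comb p.1 s]%classic.
have [|||||rho [_ rhoG]] := @linear_extension k _ _ [set: _]%classic G.
- by split.
- split=> [|c [u w] [v z] [s us /= ->] [t vt /= ->]].
    by exists [::] => //=; [split=> // x; rewrite eqxx|rewrite /comb big_nil].
  pose r := undup (s ++ t).
  have sr : {subset s <= r} by move=> x; rewrite mem_undup mem_cat => ->.
  have tr : {subset t <= r} by move=> x; rewrite mem_undup mem_cat => ->; rewrite orbT.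
  have ur : supported u r by split=> [|x /us.2/sr //]; exact: undup_uniq.
  have vr : supported v r by split=> [|x /vt.2/tr //]; exact: undup_uniq.
  exists r => /=.
    split=> [|x]; first exact: undup_uniq.
    have [u0|u0 _] := eqVneq (u x) 0; last by apply: ur.2.
    rewrite -[(c *: u + v) x]/(c * u x + v x) u0 mulr0 add0r; exact: vr.2.
  rewrite (combE u s r) // (combE v t r) // /comb scaler_sumr -big_split /=.
  by apply: eq_bigr => x _; rewrite scalerA -scalerDl.
- by [].
- move=> w [s _ /= ->]; rewrite /comb big1 // => x _; exact: scale0r.
- by move=> b; exists 0.
have [h hE] := free_pi_hom rho; exists M, h => m.
pose v (x : M) : k^o := (x == m)%:R.
exists (fun x => (v x)%:A : R); rewrite hE; apply: rhoG; exists [:: m] => /=.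
  by split=> // x; rewrite /v inE; case: (x =P m) => //= _ /negP[]; exact: eqxx.
by rewrite /comb big_seq1 /v eqxx scale1r.
Qed.

(** Functionals killing the image of [f] separate it from every other point, and each induces an
    [R]-linear map to the dual. A zero [A] gives an embedding of [M] in a power of the dual; a
    second use embeds the cokernel of that embedding. *)
Lemma kdual_pi_extension (A M : rmod R) (f : {linear A -> M}) :
  exists (Y : Type) (g : {linear M -> (Y -> (kdual R : rmod R))}), exact_at f g.
Proof.
pose Y := {phi : {linear restriction M -> k^o} | forall a, phi (f a) = 0}.
(* x is sent to the family of functionals r |-> phi (x r). *)
pose ev (x : M) (r : R) : restriction M := (r : R^c) *: x.
have ev_linear x : linear (ev x).
  move=> c r s; rewrite /ev scalerDl; congr (_ + _).
  rewrite -[RHS]/(((c%:A : R) : R^c) *: ((r : R^c) *: x)) scalerA.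
  apply: (congr1 (fun a : R^c => a *: x)).
  by rewrite -[RHS]/((r : R) * (c%:A : R)) mulr_algr.
have /choice[E EE] x : exists h : {linear R -> restriction M}, forall r, h r = ev x r.
  exact: linear_realizable.
pose g (x : M) (phi : Y) : kdual R := linfun (sval phi \o E x : {linear R -> k^o}).
have gE x phi r : (g x phi : 'Hom(R, k^o)) r = sval phi (ev x r) by rewrite lfunE /= EE.
have [|g' g'E] := @linear_realizable _ M (Y -> (kdual R : rmod R)) g.
  move=> a x y; apply/funext => phi; apply/lfunP => r; rewrite gE.
  rewrite -[RHS]/((kdual_act a (g x phi) + g y phi : 'Hom(R, k^o)) r).
  rewrite add_lfunE gE comp_lfunE gE lfunE /= -linearD.
  by congr (sval phi _); rewrite /ev scalerDr scalerA.
exists Y, g' => x; rewrite g'E; split=> [gx0|[a <-]]; last first.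
  apply/funext => phi; apply/lfunP => r; rewrite gE [RHS]lfunE /ev.
  by rewrite -linearZ; exact: (svalP phi).
apply: contrapT => xf.
have [fk fkE] : exists fk : {linear restriction A -> restriction M}, forall a, fk a = f a.
  exact/linear_realizable/linear_restrict.
(* The functional on the span of [x] and the image of [f] that is 1 at [x] and 0 on the image; it is
   well defined as [x] is not in the image. *)
pose G : set (restriction M * k^o) :=
  [set p : restriction M * k^o |
     exists a, p.1 = p.2 *: (x : restriction M) + fk a]%classic.
have [|||||phi [_ phiG]] := @linear_extension k _ _ [set: _]%classic G.
- by split.
- split=> [|c [u w] [v z] [a /= ->] [b /= ->]].
    by exists 0; rewrite /= scale0r linear0 addr0.
  exists (c *: a + b); rewrite /= linearP scalerDr scalerA addrACA -scalerDl //.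
- by [].
- move=> c [a /= /esym ca]; apply/eqP/negP => /negP c0; case: xf.
  exists ((- c^-1) *: (a : restriction A) : restriction A); rewrite -fkE linearZ /=.
  move/eqP: ca; rewrite addrC addr_eq0 => /eqP ->.
  by rewrite scaleNr scalerN opprK scalerA mulVf ?scale1r.
- by move=> b; exists 0.
have phi0 a : phi (f a) = 0 by apply: phiG; exists a; rewrite /= scale0r add0r fkE.
(* Evaluation at 1 gives [phi x], which is 1 by construction. *)
have : (g x (exist _ phi phi0) : 'Hom(R, k^o)) 1 = 0.
  by rewrite [g x]gx0; exact: lfunE.
rewrite gE /= /ev scale1r (phiG _ 1) ?(oner_eq0) //; first by move/eqP; rewrite oner_eq0.
by exists 0; rewrite /= scale1r linear0 addr0.
Qed.

Lemma projective_free_pi_retract (P : rmod R) : projective P ->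
  exists (X : Type) (s : {linear P -> (X -> regmod R)})
         (p : {linear (X -> regmod R) -> P}),
    cancel s p.
Proof.
move=> projP; have [X [p surjp]] := free_pi_generates P.
by have [s sE] := projP _ _ p idfun surjp; exists X, s, p.
Qed.

(** If [P] is a summand of R^Y, then P^X is a summand of (R^Y)^X, which is R^(X x Y) by currying. *)
Lemma projective_pi X (P : rmod R) : projective P -> projective (X -> P : rmod R).
Proof.
move=> /projective_free_pi_retract[Y [s [p sK]]].
pose curry (u : X * Y -> regmod R) : X -> Y -> regmod R := fun x y => u (x, y).
pose uncurry (u : X -> Y -> regmod R) : X * Y -> regmod R := fun z => u z.1 z.2.
have [//|c cE] := @linear_realizable _ (X * Y -> regmod R : rmod R)
  (X -> (Y -> regmod R : rmod R) : rmod R) curry.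
have [//|d dE] := @linear_realizable _
  (X -> (Y -> regmod R : rmod R) : rmod R) (X * Y -> regmod R : rmod R) uncurry.
apply: (projective_retract (s := d \o @pi_map _ X _ _ s : {linear _ -> _})
  (p := @pi_map _ X _ _ p \o c : {linear _ -> _})); last exact: free_pi_projective.
by move=> u; rewrite /= dE cE; apply/funext => x; exact: (sK (u x)).
Qed.

(** * Summands of finite sums of the regular module, and its tilting property *)

Lemma fin_sum_projective (m : nat) : projective ({ffun 'I_m -> regmod R} : rmod R).
Proof.
have [|s sE] := @linear_realizable _ ({ffun 'I_m -> regmod R} : rmod R)
  ('I_m -> regmod R : rmod R) (fun u x => u x).
  by move=> a u v; apply/funext => x; rewrite !ffunE.
have [|p pE] := @linear_realizable _ ('I_m -> regmod R : rmod R)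
  ({ffun 'I_m -> regmod R} : rmod R) (fun u => [ffun x => u x]).
  by move=> a u v; apply/ffunP => x; rewrite !ffunE.
apply: (projective_retract (s := s) (p := p)); last exact: free_pi_projective.
by move=> u; rewrite pE; apply/ffunP => x; rewrite ffunE sE.
Qed.

Lemma in_add_regular_projective (P : rmod R) : in_add (regmod R) P -> projective P.
Proof.
by move=> [m [s [p sK]]]; exact: (projective_retract sK (@fin_sum_projective m)).
Qed.

Lemma in_add_regular_fin_gen (P : rmod R) : in_add (regmod R) P -> fin_gen P.
Proof.
move=> [m [s [p sK]]].
exists m, (fun i => p [ffun j => (j == i)%:R : R]) => x; exists (fun i => s x i).
rewrite -[LHS]sK.
under eq_bigr => i _ do rewrite -linearZ.
rewrite -linear_sum; congr (p _); apply/ffunP => j.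
rewrite sum_ffunE (bigD1 j) //= !ffunE eqxx big1 => [|i /negPf ij].
  by rewrite addr0 -[RHS]/((1 : R) * (s x j : R)) mul1r.
by rewrite !ffunE eq_sym ij -[LHS]/((0 : R) * (s x i : R)) mul0r.
Qed.

Lemma in_add_self (U : rmod R) : in_add U U.
Proof.
have [|s sE] := @linear_realizable _ U ({ffun 'I_1 -> U} : rmod R) (fun x => [ffun=> x]).
  by move=> a x y; apply/ffunP => i; rewrite !ffunE.
have [|p pE] := @linear_realizable _ ({ffun 'I_1 -> U} : rmod R) U (fun u => u ord0).
  by move=> a x y; rewrite !ffunE.
by exists 1%N, s, p => x; rewrite pE sE ffunE.
Qed.

Lemma in_add_zero (U Z : rmod R) : zero_module Z -> in_add U Z.
Proof. by move=> Z0; exists 0%N, \0, \0 => x; rewrite (Z0 x). Qed.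

Lemma regular_tilting : tilting (regmod R).
Proof.
have projR := in_add_regular_projective (in_add_self (regmod R)).
have pd0 : pd_le (regmod R) 0%N by apply: syzygy_pd_le.
split.
- exists 1%N, (fun=> 1) => x; exists (fun=> x).
  by rewrite big_ord1 -[RHS]/((1 : R) * (x : R)) mul1r.
- by exists 0%N.
- have [r [proj_r len_r]] := pd0.
  move=> i; exists r; split=> // f _; exists \0 => x.
  by rewrite (len_r i.+1 isT x) !linear0.
have [Z Z0] := zero_module_exists R.
pose t i : rmod R := if i is 0%N then regmod R else Z.
pose d i : {linear t i -> t i.+1} := \0.
have inj_aug : injective (idfun : {linear regmod R -> t 0%N}) by [].
have exact_aug : exact_at (idfun : {linear regmod R -> t 0%N}) (d 0%N).
  by move=> x; split=> // _; exists x.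
have exact_d i : exact_at (d i) (d i.+1).
  by move=> x; split=> // _; exists 0; rewrite linear0 (Z0 x).
exists (Coresolution inj_aug exact_aug exact_d), 0%N; split=> [[|i]|[|i] //].
  exact: in_add_self.
exact: in_add_zero.
Qed.

(** The injective dimension [d] only starts a descending induction on the degree; the resulting
    bound [b] comes from the dual alone. *)
Lemma length_drop (d b : nat) : id_le (regmod R) d ->
  syzygy_projective b (kdual R : rmod R) ->
  forall m (M : rmod R), (b <= m)%N -> syzygy_projective m.+1 M -> syzygy_projective m M.
Proof.
move=> [c [inj_c len_c]] pdD m M bm.
have inj_cX X i : injective_module (cores_term (coresolution_pi X c) i).
  exact: injective_pi.
(* Here [j] bounds the distance from [i] up to [d]. Embedding [N] in a power of the dual trades
   degree [i] for degree [i.+1] at the cokernel. *)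
have V X j : forall i N, (b <= i)%N -> (d <= i + j)%N ->
    coext_vanishes (coresolution_pi X c) i N.
  elim: j => [|j IHj] i N bi dij.
    apply: (@coext_vanishes_length _ _ _ d); last by rewrite addn0 in dij.
    by move=> l dl u; apply/funext => x; exact: len_c.
  have [Z Z0] := zero_module_exists R.
  have [Y [f exf]] := kdual_pi_extension (\0 : {linear Z -> N}).
  have [Y' [f' exf']] := kdual_pi_extension f.
  (* The kernel of [f'] is the image of [f], so the image [C] of [f'] is the cokernel of [f]. *)
  have [C [q [p [injq surjp qp]]]] := image_realizable f'.
  apply: (@coext_vanishes_sub _ _ _ _ N _ C f p); first exact: inj_cX.
  - split=> // [x y fxy|y].
      apply/eqP; rewrite -subr_eq0; apply/eqP.
      have [z <-] // : exists z, (\0 : {linear Z -> N}) z = x - y.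
      by apply/exf; rewrite linearB fxy subrr.
    rewrite -(exf' y) -qp; split=> [->|]; first exact: linear0.
    by rewrite -[in X in _ = X -> _](linear0 q) => /injq.
  - apply: (coext_vanishes_syzygy (inj_cX X) (m := b)) => //.
    by apply: syzygy_projective_pi => // P; exact: projective_pi.
  - by apply: IHj; [exact: leqW|rewrite addSnnS].
move=> Mm; apply: (resolution_length_drop (c := fun X => coresolution_pi X c)) => //.
  exact: projective_free_pi_retract.
by move=> X; apply: (V X d) => //; exact: leq_addl.
Qed.

End Restriction.

(** * Infima of bounds and the equality of the two dimensions *)

Lemma inf_natP (A : nat -> Prop) (n : nat) :
  inf_nat A = Some n <-> A n /\ forall m, A m -> (n <= m)%N.
Proof.
rewrite /inf_nat; case: pselect => [h|h]; last first.
  by split=> // -[An _]; case: h; exists n; apply/asboolP.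
case: ex_minnP => m /asboolP Am mmin; split=> [[<-]|[An nmin]].
  by split=> // l Al; apply/mmin/asboolP.
by congr Some; apply/eqP; rewrite eqn_leq nmin // andbT; apply/mmin/asboolP.
Qed.

Lemma inf_nat_exists (A : nat -> Prop) (n : nat) :
  A n -> exists m, inf_nat A = Some m.
Proof.
move=> An; rewrite /inf_nat; case: pselect => [h|[]]; first by eexists.
by exists n; apply/asboolP.
Qed.

Theorem mainTheorem5 (k : fieldType) (R : falgType k)
    (n : nat) (L : 'I_n -> rmod R) :
  simple_representatives L ->
  properly_stratified L ->
  inhabited (simple_preserving_duality R) ->
  (forall U : rmod R, tilting U -> cotilting U) ->
  Findim R = findim R.
Proof.
move=> _ _ _ /(_ _ (@regular_tilting k R))[_ [d id_d] _ [r [m [add_r len_r]]]].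
(* Both dimensions are least upper bounds, so it suffices that they have the same upper bounds; this
   also covers the infinite case. *)
congr (inf_nat _); apply/funext => b; apply/propext; split=> bound M e.
  by move=> _; exact: bound.
move=> _ /inf_natP[pde mine].
have [e' pdD] : exists e', pd (kdual R : rmod R) = Some e'.
  apply: (@inf_nat_exists _ m); exists r; split=> // i.
  exact: in_add_regular_projective.
(* The cotilting resolution of the dual has finitely generated projective terms, so the dual is
   among the modules that [b] bounds. *)
have e'b : (e' <= b)%N.
  apply: bound pdD; exists r => i.
  by split; [exact: in_add_regular_projective|exact: in_add_regular_fin_gen].
have /inf_natP[/pd_le_syzygy syzD _] := pdD.
(* A dimension above [b] is a successor, and dropping the resolution length by one contradicts its
   minimality. *)
rewrite leqNgt; apply/negP => be; case: e pde mine be => // e pde mine be.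
have := mine e; rewrite ltnn => /(_ _)/negP; apply=> //; apply: syzygy_pd_le.
apply: (length_drop id_d syzD); last exact: pd_le_syzygy.
exact: leq_trans e'b be.
Qed.
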